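(* Let $K$ be a field of characteristic $0$, let $n\ge3$, and let $x=\sum_{i=1}^{n-1}e_{i,i+1}$ and $y=e_{n,1}$ in $\mathfrak{gl}(n,K)$. Let $\mathfrak{g}$ denote the Lie algebra generated by $x,y$. Then $\mathfrak{g}$ is simple. If $n=2m$ is even, then $\mathfrak{g}$ is of type $C_m$. If $n$ is odd, then $\mathfrak{g}$ is of type $A_{n-1}$.
   Context: $e_{i,j}$ denotes the $n\times n$ matrix with a $1$ in position $(i,j)$ and zeros elsewhere; $\mathfrak{gl}(n,K)$ carries the commutator bracket. The Lie algebra generated by $x,y$ is the smallest Lie subalgebra (over $K$) of $\mathfrak{gl}(n,K)$ containing $x$ and $y$. ''Of type $X_\ell$'' means being a split simple Lie algebra over $K$ with root system of type $X_\ell$. *)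

(* Defs.v *)
From mathcomp Require Import all_boot all_order all_algebra.

Set Implicit Arguments.
Unset Strict Implicit.
Unset Printing Implicit Defensive.

Import GRing.Theory.
Local Open Scope ring_scope.

Section LieSubalgebras.
Variables (K : fieldType) (n : nat).
Implicit Types (A B x y z h : 'M[K]_n) (U V W g H : {vspace 'M[K]_n}).

Definition lie_br A B : 'M[K]_n := A *m B - B *m A.

Definition lie_subalg U : Prop :=
  forall x y, x \in U -> y \in U -> lie_br x y \in U.

Definition lie_generated_by (X : seq 'M[K]_n) g : Prop :=
  [/\ lie_subalg g, {subset X <= g} &
      forall U, lie_subalg U -> {subset X <= U} -> (g <= U)%VS].

Definition lie_ideal g U : Prop :=
  (U <= g)%VS /\ (forall x y, x \in g -> y \in U -> lie_br x y \in U).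

Definition lie_simple g : Prop :=
  [/\ lie_subalg g,
      exists x y, [/\ x \in g, y \in g & lie_br x y != 0] &
      forall U, lie_ideal g U -> U = 0%VS \/ U = g].

(* The span of all [u, v] with u in U and v in V. *)
Definition lie_prodv U V : {vspace 'M[K]_n} :=
  <<[seq lie_br u v | u <- vbasis U, v <- vbasis V]>>%VS.

Definition lie_nilpotent U : Prop :=
  exists k, iter k (lie_prodv U) U = 0%VS.

Definition cartan_subalg g H : Prop :=
  [/\ (H <= g)%VS, lie_subalg H, lie_nilpotent H &
      forall z, z \in g -> (forall h, h \in H -> lie_br z h \in H) -> z \in H].

Definition ad_triangularizable g h : Prop :=
  exists2 b : seq 'M[K]_n, basis_of g b &
    forall i, (i < size b)%N -> lie_br h b`_i \in <<take i.+1 b>>%VS.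

Definition splitting_cartan g H : Prop :=
  cartan_subalg g H /\ (forall h, h \in H -> ad_triangularizable g h).

(* The dual space of H is 'Hom(subvs_of H, K^o). *)
Definition is_root g H (a : 'Hom(subvs_of H, K^o)) : Prop :=
  a != 0 /\
  (exists z, [/\ z \in g, z != 0 &
     forall h : subvs_of H, lie_br (vsval h) z = (a h : K) *: z]).

(* Isomorphism of root systems is meant as a linear isomorphism of the spanned *)
(* spaces carrying roots onto roots; the Cartan integers are then preserved,   *)
(* since in characteristic 0 the reflection in a root is determined by the     *)
(* root system. Here the isomorphism goes from the dual of H onto the span of  *)
(* R, so the roots of (g, H) span the dual of H.                               *)
Definition of_type g (W : vectType K) (R : seq W) : Prop :=
  lie_simple g /\
  (exists2 H, splitting_cartan g H &
   exists f : 'Hom('Hom(subvs_of H, K^o), W),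
     [/\ lker f = 0%VS, limg f = <<R>>%VS &
         forall w, w \in R <-> exists2 a, is_root g a & f a = w]).

Lemma lie_brDl A B C : lie_br (A + B) C = lie_br A C + lie_br B C.
Proof. by rewrite /lie_br mulmxDl mulmxDr opprD addrACA. Qed.

Lemma lie_brDr A B C : lie_br A (B + C) = lie_br A B + lie_br A C.
Proof. by rewrite /lie_br mulmxDl mulmxDr opprD addrACA. Qed.

Lemma lie_brZl c A B : lie_br (c *: A) B = c *: lie_br A B.
Proof. by rewrite /lie_br -scalemxAl -scalemxAr scalerBr. Qed.

Lemma lie_brZr c A B : lie_br A (c *: B) = c *: lie_br A B.
Proof. by rewrite /lie_br -scalemxAl -scalemxAr scalerBr. Qed.

Lemma lie_br0l A : lie_br 0 A = 0.
Proof. by rewrite /lie_br mul0mx mulmx0 subr0. Qed.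

Lemma lie_br0r A : lie_br A 0 = 0.
Proof. by rewrite /lie_br mul0mx mulmx0 subr0. Qed.

Lemma lie_br_suml I (r : seq I) (F : I -> 'M[K]_n) A :
  lie_br (\sum_(i <- r) F i) A = \sum_(i <- r) lie_br (F i) A.
Proof. exact: (big_morph (lie_br^~ A) (fun x y => lie_brDl x y A) (lie_br0l A)). Qed.

Lemma lie_br_sumr I (r : seq I) (F : I -> 'M[K]_n) A :
  lie_br A (\sum_(i <- r) F i) = \sum_(i <- r) lie_br A (F i).
Proof. exact: (big_morph (lie_br A) (lie_brDr A) (lie_br0r A)). Qed.

Lemma lie_prodvP U V W :
  reflect (forall x y, x \in U -> y \in V -> lie_br x y \in W)
          (lie_prodv U V <= W)%VS.
Proof.
apply: (iffP span_subvP) => [sUV x y Ux Vy | sUV _ /allpairsP[[u v] /= [Uu Vv ->]]].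
  rewrite (coord_vbasis Ux) (coord_vbasis Vy) lie_br_suml memv_suml // => i _.
  rewrite lie_br_sumr memv_suml // => j _.
  rewrite lie_brZl lie_brZr !memvZ // sUV //.
  by apply/allpairsP; exists ((vbasis U)`_i, (vbasis V)`_j);
     rewrite !mem_nth ?size_tuple.
by apply: sUV; apply: vbasis_mem.
Qed.

Lemma lie_generated_exists (X : seq 'M[K]_n) : exists g, lie_generated_by X g.
Proof.
suff [g [sXg Lg ming]] : exists g, [/\ (<<X>> <= g)%VS, lie_subalg g &
    forall U, lie_subalg U -> (<<X>> <= U)%VS -> (g <= U)%VS].
  exists g; split=> // [|U LU /span_subvP]; last exact: ming.
  exact/span_subvP.
move: <<X>>%VS => U.
have [k] := ubnP (\dim {:'M[K]_n} - \dim U).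
elim: k U => // k IHk U ltk.
have [sUU|nsUU] := boolP (lie_prodv U U <= U)%VS.
  by exists U; split=> //; apply/lie_prodvP.
have sUV : (U <= U + lie_prodv U U)%VS by apply: addvSl.
have ltUV : (\dim U < \dim (U + lie_prodv U U))%N.
  rewrite ltn_neqAle dimvS // andbT; apply: contra nsUU => eqd.
  have /eqP eqV : U == (U + lie_prodv U U)%VS by rewrite eqEdim sUV -(eqP eqd) /=.
  by rewrite [X in (_ <= X)%VS]eqV addvSr.
have [|g [sVg Lg ming]] := IHk (U + lie_prodv U U)%VS.
  rewrite -ltnS (leq_trans _ ltk) // ltnS ltn_sub2l //.
  exact: leq_trans ltUV (dimvS (subvf _)).
exists g; split=> // [|W LW sUW]; first exact: subv_trans sVg.
apply: ming => //; rewrite subv_add sUW; apply/lie_prodvP => x y Ux Uy.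
by apply: LW; apply: (subvP sUW).
Qed.

End LieSubalgebras.

Section StandardRootSystems.
Variable K : fieldType.

Definition eps N (i : 'I_N) : 'rV[K]_N := delta_mx 0 i.

(* e_i - e_j for i != j, in K^(l+1). *)
Definition rootsA (l : nat) : seq 'rV[K]_l.+1 :=
  [seq eps p.1 - eps p.2 | p <- enum {: 'I_l.+1 * 'I_l.+1} & p.1 != p.2].

Definition pm (b : bool) : K := (-1) ^+ b.

(* +-e_i +- e_j for i < j, and +-2 e_i, in K^m. *)
Definition rootsC (m : nat) : seq 'rV[K]_m :=
  [seq pm s.1 *: eps p.1 + pm s.2 *: eps p.2
     | p <- [seq q : 'I_m * 'I_m <- enum {: 'I_m * 'I_m} | (q.1 < q.2)%N],
       s <- enum {: bool * bool}]
  ++ [seq pm s *: (eps i *+ 2) | i <- enum 'I_m, s <- enum {: bool}].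

End StandardRootSystems.

(* Matrix indices start at 0: shift_mx is the sum of the e_{i,i+1} and        *)
(* corner_mx is e_{n,1} in 1-based notation.                                 *)
Definition shift_mx (K : fieldType) (n : nat) : 'M[K]_n :=
  \matrix_(i, j) (j == i.+1 :> nat)%:R.

Definition corner_mx (K : fieldType) (n : nat) : 'M[K]_n :=
  \matrix_(i, j) ((i.+1 == n) && (j == 0 :> nat))%:R.

(* Main.v *)
(** With x = shift_mx and y = corner_mx, w := (ad x)^(n-1) y is diagonal with
    entries (-1)^j C(n-1, j), so [ad w] acts on e_(i,i+1) by (-1)^i C(n, i+1).
    These eigenvalues are distinct when n is odd, and coincide exactly for i and
    n-2-i when n is even. Projecting x on the eigenspaces therefore shows that g
    contains the simple root vectors of sl_n, respectively of the symplectic Lie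
    algebra fixed by A |-> - (-1)^(i+j) A_(n-1-j,n-1-i); together with y they
    generate all root vectors E_ij. A nonzero ideal contains some E_ij, because
    (ad E_ji)^2 A = - 2 E_ji A E_ji is a multiple of E_ji, and then all of them,
    hence x and y. The diagonal matrices of g form a splitting Cartan subalgebra
    with roots h |-> h_i - h_j. *)

Require Import Defs.
From HB Require Import structures.
From mathcomp Require Import all_boot all_order all_algebra.
From mathcomp Require Import ring zify.

Set Implicit Arguments.
Unset Strict Implicit.
Unset Printing Implicit Defensive.

Import GRing.Theory.
Local Open Scope ring_scope.

(** * Coincidences between binomial coefficients in one row *)

Section Binomials.
(** From [(j+1) C(n, j+1) = (n-j) C(n, j)], where [n - j > j + 1] in the lower half of the row. *)
Lemma ltn_bin_half (n i j : nat) : (i < j)%N -> (2 * j <= n)%N -> ('C(n, i) < 'C(n, j))%N.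
Proof.
move=> lt_ij; elim: j lt_ij => // j IHj lt_ij le_jn.
have ltj : ('C(n, j) < 'C(n, j.+1))%N.
  have := mul_bin_left n j; have : (0 < 'C(n, j))%N by rewrite bin_gt0; lia.
  nia.
case: (ltngtP i j) => [/IHj IH||->] //; last by lia.
by apply: ltn_trans (IH _) ltj; lia.
Qed.

Lemma eq_bin (n i j : nat) : (i <= n)%N -> (j <= n)%N -> 'C(n, i) = 'C(n, j) ->
  i = j \/ (i + j)%N = n.
Proof.
(* The symmetry [C(n, i) = C(n, n-i)] brings both indices into the lower half, where the row is
   strictly increasing. *)
wlog le_i: i / (2 * i <= n)%N => [IH|].
  move=> le_in; case: (leqP (2 * i) n) => [le2 | lt2]; first exact: IH.
  rewrite -(bin_sub le_in) => le_jn /(IH (n - i)%N).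
  by case=> //; lia.
wlog le_j: j / (2 * j <= n)%N => [IH|].
  move=> le_in le_jn; case: (leqP (2 * j) n) => [le2 | lt2]; first exact: IH.
  rewrite -(bin_sub le_jn) => /(IH (n - j)%N).
  by case=> //; lia.
move=> _ _ eqC; case: (ltngtP i j) => [lt|lt|]; [| |by left].
  by have := ltn_bin_half lt le_j; lia.
by have := ltn_bin_half lt le_i; lia.
Qed.
End Binomials.

(** * Bracketing with a diagonal matrix *)

Section Brackets.
Variables (K : fieldType) (n : nat).
Implicit Types (A B w : 'M[K]_n) (U : {vspace 'M[K]_n}).

Lemma lie_br_diag w A i j : is_diag_mx w ->
  lie_br w A i j = (w i i - w j j) * A i j.
Proof.
case/diag_mxP=> d ->; rewrite /lie_br mul_diag_mx mul_mx_diag !mxE !eqxx !mulr1n.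
by rewrite mulrBl [A i j * _]mulrC.
Qed.

(* A product of the operators [ad w - d] over the weights [d != c] of [ad w]. *)
Lemma weight_component w U A (c : K) : is_diag_mx w ->
    (forall B, B \in U -> lie_br w B \in U) -> A \in U ->
  \matrix_(i, j) (A i j *+ (w i i - w j j == c)) \in U.
Proof.
move=> w_diag stabU UA.
pose p (s : seq K) (v : K) := \prod_(d <- s) (v - d).
have Up s : \matrix_(i, j) (p s (w i i - w j j) * A i j) \in U.
  elim: s => [|d s IHs].
    by congr (_ \in U): UA; apply/matrixP=> i j; rewrite mxE /p big_nil mul1r.
  have := rpredB (stabU _ IHs) (rpredZ d IHs).
  congr (_ \in U); apply/matrixP=> i j.
  by rewrite !(lie_br_diag _ _ _ w_diag, mxE) /p big_cons; ring.
pose s := [seq w ij.1 ij.1 - w ij.2 ij.2 | ij <- enum {: 'I_n * 'I_n} & w ij.1 ij.1 - w ij.2 ij.2 != c].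
have pc0 : p s c != 0.
  rewrite prodf_seq_neq0; apply/allP=> d /mapP[ij].
  by rewrite mem_filter => /andP[neq _] -> /=; rewrite subr_eq0 eq_sym.
(* Dividing by [p s c] turns the operator into the projection onto weight [c]. *)
have := rpredZ (p s c)^-1 (Up s); congr (_ \in U); apply/matrixP=> i j; rewrite !mxE.
case: eqP => [->|/eqP neq]; first by rewrite mulrA mulVf ?mul1r.
suff -> : p s (w i i - w j j) = 0 by rewrite mul0r mulr0.
apply/eqP; rewrite prodf_seq_eq0; apply/hasP; exists (w i i - w j j); rewrite ?subrr //=.
by apply/mapP; exists (i, j) => //; rewrite mem_filter /= neq mem_enum.
Qed.

End Brackets.

(** * Index reversal, which flips parity when [n] is even *)

Section RevOrd.
Variable n : nat.
Implicit Types i j : 'I_n.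

Lemma odd_rev_ord i : ~~ odd n -> odd (rev_ord i) = ~~ odd i.
Proof. by move=> evn; have := ltn_ord i; rewrite /=; lia. Qed.

Lemma rev_ord_neq i : ~~ odd n -> rev_ord i != i.
Proof. by move=> evn; apply/eqP => e; have := odd_rev_ord i evn; rewrite e; case: odd. Qed.

Lemma rev_ord_eq i j : (rev_ord i == j) = (i == rev_ord j).
Proof. by rewrite -(inj_eq rev_ord_inj) rev_ordK. Qed.

End RevOrd.

(** * Root vectors, and the subalgebras and ideals containing them *)

Section RootVectors.
Variables (K : fieldType) (n : nat).
Hypotheses (charK0 : [pchar K] =i pred0) (n_ge3 : (3 <= n)%N).
Implicit Types (i j k l : 'I_n) (A B h : 'M[K]_n) (U g : {vspace 'M[K]_n}).

(* For even [n], [A] |-> [- (-1)^(i + j) A_(n-1-j, n-1-i)] is the involution   *)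
(* whose fixed points form the symplectic Lie algebra containing the two       *)
(* generators; the second summand is the image of [delta_mx i j] under it.     *)
Definition root_mx i j : 'M[K]_n :=
  delta_mx i j +
  (if odd n then 0 else (-1) ^+ (i + j).+1 *: delta_mx (rev_ord j) (rev_ord i)).

Lemma natr_neq0 (m : nat) : (0 < m)%N -> (m%:R : K) != 0.
Proof. by move/pcharf0P: charK0 => ->; rewrite lt0n. Qed.

Lemma root_mx_odd i j : odd n -> root_mx i j = delta_mx i j.
Proof. by rewrite /root_mx => ->; rewrite addr0. Qed.

Lemma root_mx_even i j : ~~ odd n -> root_mx i j =
  delta_mx i j + (-1) ^+ (~~ (odd i (+) odd j)) *: delta_mx (rev_ord j) (rev_ord i).
Proof. by rewrite /root_mx => /negbTE ->; rewrite -signr_odd /= oddD. Qed.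

Lemma root_mx_long i : ~~ odd n -> root_mx i (rev_ord i) = 2 *: delta_mx i (rev_ord i).
Proof.
move=> evn; rewrite root_mx_even // rev_ordK odd_rev_ord // addbN addbb /=.
by rewrite expr0 scale1r scaler_nat mulr2n.
Qed.

Lemma root_mxM i j k : i != j -> j != k -> i != k ->
  exists2 c : K, c != 0 & lie_br (root_mx i j) (root_mx j k) = c *: root_mx i k.
Proof.
move=> nij njk nik; case: (boolP (odd n)) => [oddn|evn].
  exists 1; first exact: oner_neq0.
  rewrite !root_mx_odd // /lie_br !mul_delta_mx_cond eqxx eq_sym (negbTE nik).
  by rewrite subr0 scale1r.
(* [e] tells whether a factor is a long root vector, hence twice a matrix unit; not both are, since
   that would give [i = k]. *)
pose e := (j == rev_ord k) || (i == rev_ord j).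
exists (1 + e%:R); first by rewrite -[1]/(1%:R) -natrD natr_neq0.
rewrite !root_mx_even // /lie_br !mulmxDl !mulmxDr -!scalemxAl -!scalemxAr.
rewrite !mul_delta_mx_cond !eqxx (inj_eq rev_ord_inj) (negbTE nik) [k == i]eq_sym (negbTE nik).
rewrite !rev_ord_eq !mulr0n !mulr1n !scaler0 [k == _]eq_sym rev_ord_eq.
rewrite [j == rev_ord i]eq_sym rev_ord_eq.
rewrite /e; case: eqP => [ejk|_] /=; first case: eqP => [eij|_] /=.
- by rewrite eij ejk rev_ordK eqxx in nik.
- rewrite ejk rev_ordK !odd_rev_ord //.
  by apply/matrixP=> a b; rewrite !mxE; case: (odd i); case: (odd k); rewrite /= ?expr0 ?expr1; ring.
- case: eqP => [eij|_] /=; apply/matrixP=> a b; rewrite !mxE.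
    rewrite eij rev_ordK !odd_rev_ord //.
    by case: (odd j); case: (odd k); rewrite /= ?expr0 ?expr1; ring.
  by case: (odd i); case: (odd j); case: (odd k); rewrite /= ?expr0 ?expr1; ring.
Qed.

Lemma root_mx_mem_br U i j k : i != j -> j != k -> i != k ->
  (lie_br (root_mx i j) (root_mx j k) \in U) = (root_mx i k \in U).
Proof. by move=> ij jk /(root_mxM ij jk)[c c0 ->]; rewrite rpredZeq (negbTE c0). Qed.

Lemma root_mx_corner i j : i.+1 = n -> j = 0 :> nat ->
  exists2 c : K, c != 0 & root_mx i j = c *: corner_mx K n.
Proof.
move=> i1 j0.
have cE : corner_mx K n = delta_mx i j.
  apply/matrixP=> a b; rewrite !mxE; congr (nat_of_bool _)%:R.
  rewrite -!val_eqE /= j0; have -> : (a == i :> nat) = (a.+1 == n) by lia.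
  by [].
case: (boolP (odd n)) => oddn.
  by exists 1; rewrite ?oner_neq0 // root_mx_odd // scale1r.
exists 2; rewrite ?natr_neq0 //.
have -> : j = rev_ord i by apply/val_inj; rewrite /= i1 j0 subnn.
rewrite root_mx_long // cE; congr (_ *: delta_mx _ _).
by apply/val_inj; rewrite /= i1 j0 subnn.
Qed.

(** Brackets climb from the superdiagonal to every [i < j]. The corner then yields column 0 through
    [[E_(i,n-1), E_(n-1,0)]], and the other entries below the diagonal arise as
    [[E_(i,0), E_(0,j)]]. *)
Lemma lie_subalg_root_mx U : lie_subalg U -> corner_mx K n \in U ->
    (forall i j, j = i.+1 :> nat -> root_mx i j \in U) ->
  forall i j, i != j -> root_mx i j \in U.
Proof.
move=> LU Uc Us.
have step i j k : i != j -> j != k -> i != k ->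
    root_mx i j \in U -> root_mx j k \in U -> root_mx i k \in U.
  by move=> ij jk ik Uij Ujk; rewrite -(root_mx_mem_br U ij jk ik) LU.
have up d i j : j = (i + d.+1)%N :> nat -> root_mx i j \in U.
  elim: d i j => [|d IHd] i j e; first by apply: Us; rewrite e addn1.
  have ltk : (i + d.+1 < n)%N by have := ltn_ord j; lia.
  apply: (@step i (Ordinal ltk) j); rewrite -?val_eqE /=; try lia; first exact: IHd.
  by apply: Us; rewrite e /=; lia.
have {}up i j : (i < j)%N -> root_mx i j \in U by move=> lt; apply: (@up (j - i).-1); lia.
have lt0 : (0 < n)%N by lia.
have ltm : (n.-1 < n)%N by lia.
pose o := Ordinal lt0; pose m := Ordinal ltm.
have Umo : root_mx m o \in U.
  by have [||c _ ->] := @root_mx_corner m o; rewrite /= ?prednK // rpredZ.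
have colo i : i != o -> root_mx i o \in U.
  move=> io; have [->//|im] := eqVneq i m; apply: (@step i m o) => //.
    by rewrite -val_eqE /=; lia.
  by apply: up; have := ltn_ord i; move: im; rewrite -val_eqE /=; lia.
move=> i j ij; have [lt|ge] := ltnP i j; first exact: up.
have [->|jo] := eqVneq j o; first by apply: colo; move: ij ge; rewrite -!val_eqE /=; lia.
have io : i != o by move: ij ge jo; rewrite -!val_eqE /=; lia.
apply: (@step i o j) => //; [by rewrite eq_sym|exact: colo|].
by apply: up; move: jo; rewrite -val_eqE /=; lia.
Qed.

Lemma third_index i j : exists2 k, k != i & k != j.
Proof.
have : (0 < #|~: [set i; j]|)%N.
  by rewrite cardsCs setCK card_ord cards2; case: (i != j); lia.
by case/card_gt0P=> k; rewrite !inE negb_or => /andP[]; exists k.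
Qed.

(** Bracketing changes one index of a root vector at a time, as long as the two indices stay
    distinct; a third index serves as a stopover. *)
Lemma ideal_root_mx g U i j : (forall k l, k != l -> root_mx k l \in g) -> 
    lie_ideal g U -> i != j -> root_mx i j \in U ->
  forall k l, k != l -> root_mx k l \in U.
Proof.
move=> gE [_ idU].
have stepr a b c : a != b -> b != c -> a != c -> root_mx a b \in U -> root_mx a c \in U.
  move=> ab bc ac Uab; rewrite -(root_mx_mem_br U ab bc ac).
  have := idU _ _ (gE _ _ bc) Uab; rewrite -rpredN.
  by rewrite /lie_br opprB.
have stepl a b c : a != b -> b != c -> a != c -> root_mx b c \in U -> root_mx a c \in U.
  by move=> ab bc ac Ubc; rewrite -(root_mx_mem_br U ab bc ac) idU ?gE.
have move_r a b c : a != b -> a != c -> root_mx a b \in U -> root_mx a c \in U.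
  by move=> ab ac Uab; have [<-//|bc] := eqVneq b c; apply: (@stepr a b c).
have move_l a b c : a != c -> b != c -> root_mx a c \in U -> root_mx b c \in U.
  by move=> ac bc Uac; have [<-//|ba] := eqVneq a b; apply: (@stepl b a c) => //; rewrite eq_sym.
(* The route is [(i,j)], [(i,m)], [(k,m)], [(k,l)]. If [k = m] it passes through [(i,l)] instead,
   and if moreover [i = l], through [(i,p)] and [(k,p)]. *)
move=> ij Uij k l kl; have [m mi ml] := third_index i l.
have im : i != m by rewrite eq_sym.
have Uim := move_r _ _ _ ij im Uij.
have [km|km] := eqVneq k m; last first.
  exact: move_r km kl (move_l _ _ _ im km Uim).
have [li|il] := eqVneq i l; last exact: move_l il kl (move_r _ _ _ ij il Uij).
have [p pi pm] := third_index i m.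
have ip : i != p by rewrite eq_sym.
have mp : m != p by rewrite eq_sym.
apply: (move_r k p l) => //; rewrite km //.
exact: move_l ip mp (move_r _ _ _ ij ip Uij).
Qed.

End RootVectors.

(** * The anti-automorphism behind the symplectic form *)

Section Twist.
Variables (K : fieldType) (n : nat).

(** This is [J A^T J^-1] for the antidiagonal matrix [J] with alternating signs. For even [n], [J]
    is skew-symmetric and the equation [twist A = - A] defines its symplectic Lie algebra. *)
Definition twist (A : 'M[K]_n) : 'M[K]_n :=
  \matrix_(i, j) ((-1) ^+ (i + j) * A (rev_ord j) (rev_ord i)).

Fact twist_is_linear : linear twist.
Proof. by move=> c A B; apply/matrixP=> i j; rewrite !mxE; ring. Qed.
HB.instance Definition _ := GRing.isLinear.Build K 'M[K]_n 'M[K]_n _ twist twist_is_linear.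

Lemma twistM A B : twist (A *m B) = twist B *m twist A.
Proof.
apply/matrixP=> i j; rewrite !mxE mulr_sumr (reindex_inj rev_ord_inj) /=.
apply: eq_bigr => k _; rewrite !mxE.
have -> : (-1) ^+ (i + j) = (-1) ^+ (i + k) * (-1) ^+ (k + j) :> K.
  by rewrite -exprD -signr_odd -[RHS]signr_odd; congr (_ ^+ nat_of_bool _); lia.
by ring.
Qed.
End Twist.

(** * Linear constraints on [g], and the root vectors it contains *)

Section GeneratedAlgebra.
Variables (K : fieldType) (n : nat).
Hypotheses (charK0 : [pchar K] =i pred0) (n_ge3 : (3 <= n)%N).
Variable g : {vspace 'M[K]_n}.
Hypothesis g_gen : lie_generated_by [:: shift_mx K n; corner_mx K n] g.
Implicit Types (i j k l : 'I_n) (A B h : 'M[K]_n) (U : {vspace 'M[K]_n}).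

Lemma gen_subalg : lie_subalg g. Proof. by case: g_gen. Qed.
Lemma gen_shift : shift_mx K n \in g.
Proof. by case: g_gen => _ -> //; rewrite mem_head. Qed.
Lemma gen_corner : corner_mx K n \in g.
Proof. by case: g_gen => _ -> //; rewrite !inE eqxx orbT. Qed.

(** Minimality of [g] against the kernel of the trace. *)
Lemma gen_trace A : A \in g -> \tr A = 0.
Proof.
case: g_gen => _ _ /(_ (lker (linfun (@mxtrace K n : 'M[K]_n -> K^o)))) min_g.
move=> gA; have : A \in lker (linfun (@mxtrace K n : 'M[K]_n -> K^o)).
  apply: (subvP (min_g _ _)) gA => [B C _ _|B].
    by rewrite memv_ker lfunE /= /lie_br raddfB /= mxtrace_mulC subrr.
  rewrite !inE => /orP[] /eqP->; rewrite memv_ker lfunE /= /mxtrace big1 // => i _.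
    by rewrite mxE; case: eqP => //; lia.
  by rewrite mxE; case: andP => // -[]; lia.
by rewrite memv_ker lfunE => /eqP.
Qed.

(** Minimality of [g] against the kernel of [twist + 1], which is closed under brackets because
    [twist] reverses products. *)
Lemma gen_symplectic A i j : ~~ odd n -> A \in g ->
  A (rev_ord j) (rev_ord i) = - (-1) ^+ (i + j) * A i j.
Proof.
move=> evn gA; case: g_gen => _ _ min_g.
pose f := (linfun (@twist K n) + \1)%VF.
have fE B : (B \in lker f) = (twist B == - B).
  by rewrite memv_ker /f add_lfunE id_lfunE lfunE /= addr_eq0.
have : A \in lker f.
  apply: (subvP (min_g _ _ _)) gA => [B C|B].
    rewrite !fE => /eqP tB /eqP tC; rewrite /lie_br raddfB /= !twistM tB tC.
    by rewrite !mulNmx !mulmxN !opprK opprB.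
  rewrite !inE fE => /orP[] /eqP->; apply/eqP/matrixP=> a b; rewrite !mxE /=.
    have -> : (n - a.+1 == (n - b.+1).+1)%N = (b == a.+1 :> nat).
      by have := ltn_ord a; have := ltn_ord b; lia.
    case: eqP => [->|_]; last by rewrite mulr0 oppr0.
    by rewrite mulr1 -signr_odd addnS /= addnn odd_double.
  have -> : ((n - b.+1).+1 == n) && (n - a.+1 == 0)%N = (a.+1 == n) && (b == 0 :> nat).
    by have := ltn_ord a; have := ltn_ord b; lia.
  case: andP => [[/eqP an /eqP ->]|_]; last by rewrite mulr0 oppr0.
  by rewrite mulr1 -signr_odd; have -> : odd (a + 0) by lia.
rewrite fE => /eqP/matrixP/(_ i j); rewrite !mxE => e.
by rewrite -[A i j in RHS]opprK -e mulrN mulNr opprK signrMK.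
Qed.

(* (ad x)^k y, whose entries lie on the diagonal [i + k = n - 1 + j]. *)
Lemma gen_ad_shift (k : nat) :
  \matrix_(i, j) (((i + k)%N == (n.-1 + j)%N)%:R * ((-1) ^+ j * 'C(k, j)%:R)) \in g.
Proof.
elim: k => [|k IHk].
  have := gen_corner; congr (_ \in g); apply/matrixP=> i j; rewrite !mxE.
  rewrite addn0 bin0n; case: (eqVneq (j : nat) 0%N) => [->|_].
    by rewrite expr0 !mulr1 addn0 andbT; congr (nat_of_bool _)%:R; lia.
  by rewrite andbF !mulr0.
have := gen_subalg gen_shift IHk; congr (_ \in g); apply/matrixP=> i j.
pose F (a b : nat) : K := ((a + k)%N == (n.-1 + b)%N)%:R * ((-1) ^+ b * 'C(k, b)%:R).
(* Multiplying by [shift_mx] on the left reads row [i + 1], on the right column [j - 1]. Past the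
   last row [F] vanishes: its only candidate entry has [j = k + 1], where [C(k, j) = 0]. The factor
   [0 < j] handles the missing column, and Pascal's rule concludes. *)
transitivity (F i.+1 j - F i j.-1 *+ (0 < j)%N).
  rewrite /lie_br !mxE; congr (_ - _).
    have [lt|ge] := ltnP i.+1 n.
      rewrite (bigD1 (Ordinal lt)) //= !mxE eqxx mul1r big1 ?addr0 // => l.
      by rewrite -val_eqE /= !mxE => /negbTE->; rewrite mul0r.
    rewrite big1 => [|l _]; last by rewrite !mxE ltn_eqF ?mul0r // (leq_trans _ ge).
    rewrite /F; case: eqP => [e|_]; last by rewrite mul0r.
    by rewrite bin_small ?mulr0 //; lia.
  have [j0|j0] := posnP j.
    by rewrite big1 // => l _; rewrite !mxE j0 mulr0.
  have lt : (j.-1 < n)%N by have := ltn_ord j; lia.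
  rewrite (bigD1 (Ordinal lt)) //= !mxE prednK // eqxx mulr1 big1 ?addr0 // => l.
  rewrite -val_eqE /= !mxE => ne; have -> : (j == l.+1 :> nat) = false by lia.
  by rewrite mulr0.
rewrite mxE /F; case: (nat_of_ord j) => [|m] /=.
  by rewrite subr0 addSnnS !bin0.
rewrite addSnnS mulr1n binS natrD exprS.
have -> : ((i + k == n.-1 + m) = (i + k.+1 == n.-1 + m.+1))%N by lia.
by ring.
Qed.

Lemma gen_diag : diag_mx (\row_j ((-1) ^+ j * 'C(n.-1, j)%:R)) \in g.
Proof.
have := gen_ad_shift n.-1; congr (_ \in g); apply/matrixP=> i j; rewrite !mxE.
rewrite addnC eqn_add2l val_eqE; case: eqP => [->|_]; first by rewrite mul1r.
by rewrite mul0r.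
Qed.

Lemma natr_inj_pchar0 (m p : nat) : m%:R = p%:R :> K -> m = p.
Proof.
wlog le_mp : m p / (m <= p)%N => [IH|/eqP].
  by case: (leqP m p) => [/IH//|/ltnW/IH] H /esym/H.
rewrite eq_sym -subr_eq0 -natrB //; move/pcharf0P: charK0 => ->; lia.
Qed.

(* The eigenvalues of [gen_diag] on the matrix units of the superdiagonal      *)
(* separate them, up to the reflection [i |-> n - 2 - i] when [n] is even.     *)
Lemma sign_bin_eq (a i : nat) : (a.+1 < n)%N -> (i.+1 < n)%N ->
  ((-1) ^+ a * 'C(n, a.+1)%:R == (-1) ^+ i * 'C(n, i.+1)%:R :> K) =
  (a == i) || ~~ odd n && ((a + i).+2 == n).
Proof.
move=> lta lti; have posi : (0 < 'C(n, i.+1))%N by rewrite bin_gt0 ltnW.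
apply/eqP/orP => [|[/eqP->//|/andP[evn /eqP e]]]; last first.
  have -> : 'C(n, a.+1) = 'C(n, i.+1) by rewrite -(bin_sub (ltnW lti)); congr binomial; lia.
  by rewrite -signr_odd -[in RHS]signr_odd; congr ((-1) ^+ nat_of_bool _ * _); lia.
rewrite -signr_odd -[in RHS]signr_odd.
have [eo|neo] := eqVneq (odd a) (odd i).
  rewrite eo => /(canLR (signrMK _)); rewrite signrMK => /esym/natr_inj_pchar0 eqC.
  by have [[->]|e] := eq_bin (ltnW lta) (ltnW lti) (esym eqC); [left | right; lia].
(* Opposite signs would make a positive integer vanish in [K]. *)
move=> e; have /eqP : ('C(n, a.+1) + 'C(n, i.+1))%:R = 0 :> K.
  rewrite natrD; move: e neo; case: (odd a); case: (odd i) => //=; rewrite ?expr0 ?expr1 !(mulN1r, mul1r).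
    by move<-; rewrite subrr.
  by move->; rewrite addNr.
by move/pcharf0P: charK0 => ->; lia.
Qed.

Lemma gen_simple_root_mx i j : j = i.+1 :> nat -> root_mx K i j \in g.
Proof.
move=> ji.
pose w := diag_mx (\row_j ((-1) ^+ j * 'C(n.-1, j)%:R)) : 'M[K]_n.
have wE (a b : 'I_n) : b = a.+1 :> nat -> w a a - w b b = (-1) ^+ a * 'C(n, a.+1)%:R.
  move=> e; rewrite !mxE !eqxx !mulr1n e exprS.
  have -> : 'C(n, a.+1) = ('C(n.-1, a.+1) + 'C(n.-1, a))%N by rewrite -binS prednK //; lia.
  by rewrite natrD; ring.
have := @weight_component _ _ w g (shift_mx K n) (w i i - w j j) (diag_mx_is_diag _)
  (fun B => gen_subalg gen_diag) gen_shift.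
set B := (X in X \in g) => gB.
(* The weight component keeps the entry [(i, j)] of [shift_mx] and, for even [n], its mirror image
   [(rev_ord j, rev_ord i)]. *)
have BE a b : B a b = ((b == a.+1 :> nat) && ((a == i) || ~~ odd n && (a == rev_ord j)))%:R.
  rewrite mxE mxE; case: eqP => [e|_]; last by rewrite mul0rn.
  rewrite !wE // sign_bin_eq -?e -?ji ?ltn_ord // -mulr_natr mul1r.
  congr (nat_of_bool (_ || (_ && _)))%:R; rewrite -val_eqE /=.
  by have := ltn_ord a; have := ltn_ord j; lia.
suff [c ->] : exists c, root_mx K i j = c *: B by rewrite rpredZ.
have ii : (rev_ord i = (rev_ord j).+1 :> nat) by have := ltn_ord j; rewrite /=; lia.
have abE (a b c d : 'I_n) : d = c.+1 :> nat ->
    (a == c) && (b == d) = (b == a.+1 :> nat) && (a == c).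
  by rewrite -!val_eqE /=; lia.
case: (boolP (odd n)) => oddn.
  exists 1; rewrite scale1r root_mx_odd //; apply/matrixP=> a b.
  by rewrite BE mxE oddn orbF (abE a b i j).
(* If [(i, j)] is its own mirror image, [root_mx] counts the matrix unit twice but [B] only once. *)
exists (1 + (i == rev_ord j)%:R); rewrite root_mx_even //; apply/matrixP=> a b.
rewrite [RHS]mxE BE oddn !mxE ji /= addbN addbb expr0 mul1r.
rewrite (abE _ _ _ _ ji) (abE _ _ _ _ ii); case: eqP => //= _; last by rewrite mulr0 addr0.
case: (eqVneq i (rev_ord j)) => [->|ne]; first by case: (a == _); rewrite /=; ring.
have [->|_] := eqVneq a i; first by rewrite (negbTE ne) /=; ring.
by rewrite /=; ring.
Qed.

Lemma gen_root_mx i j : i != j -> root_mx K i j \in g.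
Proof.
move: i j; apply: lie_subalg_root_mx => //; [exact: gen_subalg|exact: gen_corner|].
exact: gen_simple_root_mx.
Qed.

End GeneratedAlgebra.

(** * Matrix-unit identities and bases of eigenvectors *)

Section MoreMatrices.
Variables (K : fieldType) (n : nat).
Implicit Types (A E : 'M[K]_n).

Lemma mul_delta_mx_delta A (i j k l : 'I_n) :
  delta_mx i j *m A *m delta_mx k l = A j k *: delta_mx i l.
Proof.
rewrite -(mul_delta_mx (0 : 'I_1) i j) -(mul_delta_mx (0 : 'I_1) k l).
rewrite -!mulmxA [delta_mx 0 j *m _]mulmxA -rowE [row j A *m _]mulmxA -colE.
rewrite [col _ _]mx11_scalar !mxE mul_scalar_mx.
by rewrite -scalemxAr mul_delta_mx.
Qed.

Lemma lie_br_sqr0 E A : E *m E = 0 -> lie_br E (lie_br E A) = - 2 *: (E *m A *m E).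
Proof.
move=> E2; rewrite /lie_br mulmxBr mulmxBl !mulmxA E2 mul0mx sub0r.
by rewrite -[A *m E *m E]mulmxA E2 mulmx0 subr0 -opprD scaleNr scaler_nat mulr2n.
Qed.

Lemma lie_brC A E : lie_br A E = - lie_br E A.
Proof. by rewrite /lie_br opprB. Qed.

Lemma span_free_subseq (vT : vectType K) (X : seq vT) :
  exists b : seq vT, [/\ {subset b <= X}, free b & <<b>>%VS = <<X>>%VS].
Proof.
elim: X => [|x X [b [sub free_b span_b]]]; first by exists [::]; rewrite nil_free.
have [xX|nxX] := boolP (x \in <<X>>%VS).
  exists b; split=> // [y /sub|]; first by rewrite inE orbC => ->.
  by rewrite span_b span_cons; apply/esym/addv_idPr; rewrite -memvE.
exists (x :: b); rewrite free_cons span_b nxX free_b; split=> //; last by rewrite !span_cons span_b.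
by move=> y; rewrite !inE => /orP[->//|/sub->]; rewrite orbT.
Qed.

(** A basis extracted from the spanning eigenvectors makes [ad h] diagonal, hence triangular. *)
Lemma ad_triangularizable_eigen (g : {vspace 'M[K]_n}) (X : seq 'M[K]_n) (h : 'M[K]_n) :
    <<X>>%VS = g -> {in X, forall v, exists c : K, lie_br h v = c *: v} ->
  ad_triangularizable g h.
Proof.
move=> Xg eigX; have [b [sub free_b span_b]] := span_free_subseq X.
exists b; first by rewrite /basis_of span_b Xg eqxx.
move=> i ltib; have [|c ->] := eigX b`_i; first by rewrite sub ?mem_nth.
by rewrite rpredZ // memv_span // -[b`_i](nth_take 0 (ltnSn i)) mem_nth // size_takel.
Qed.

End MoreMatrices.

(** * Simplicity of [g] *)

Section SimpleAlgebra.
Variables (K : fieldType) (n : nat).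
Hypotheses (charK0 : [pchar K] =i pred0) (n_ge3 : (3 <= n)%N).
Variable g : {vspace 'M[K]_n}.
Hypothesis g_gen : lie_generated_by [:: shift_mx K n; corner_mx K n] g.
Implicit Types (i j k l : 'I_n) (A B h : 'M[K]_n) (U : {vspace 'M[K]_n}).

Local Notation E := (root_mx K).
Let two_neq0 : (2 : K) != 0. Proof. exact: (natr_neq0 charK0). Qed.
Let n_neq0 : (n%:R : K) != 0. Proof. by apply: (natr_neq0 charK0); lia. Qed.

Lemma root_mx_neq0 i j : E i j != 0.
Proof.
apply/eqP => /matrixP/(_ i j)/eqP; rewrite [X in _ == X]mxE.
case: (boolP (odd n)) => oddn; first by rewrite root_mx_odd // mxE !eqxx oner_eq0.
have [->|ji] := eqVneq j (rev_ord i).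
  by rewrite root_mx_long // !mxE !eqxx mulr1 (negbTE two_neq0).
by rewrite root_mx_even // !mxE !eqxx (negbTE ji) andbF mulr0 addr0 oner_eq0.
Qed.

Lemma root_mx_sqr i j : i != j -> E i j *m E i j = 0.
Proof.
move=> ij; case: (boolP (odd n)) => oddn.
  by rewrite !root_mx_odd // mul_delta_mx_cond eq_sym (negbTE ij).
have ji : (j == i) = false by rewrite eq_sym (negbTE ij).
rewrite !root_mx_even // mulmxDl !mulmxDr -!scalemxAl -!scalemxAr.
rewrite !mul_delta_mx_cond (inj_eq rev_ord_inj) (negbTE ij) ji.
rewrite ![_ == rev_ord _]eq_sym !(negbTE (rev_ord_neq _ oddn)).
by rewrite !mulr0n !scaler0 !addr0.
Qed.

Lemma gen_diag_rev h i : ~~ odd n -> h \in g -> h (rev_ord i) (rev_ord i) = - h i i.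
Proof.
by move=> evn gh; rewrite (gen_symplectic n_ge3 g_gen) // -signr_odd addnn odd_double mulN1r.
Qed.

(** For even [n] both matrix units in [root_mx i j] have the same weight, because [rev_ord] negates
    the diagonal of [h]. *)
Lemma lie_br_root_mx h i j : h \in g -> is_diag_mx h ->
  lie_br h (E i j) = (h i i - h j j) *: E i j.
Proof.
move=> gh h_diag; apply/matrixP=> a b; rewrite lie_br_diag // [RHS]mxE.
case: (boolP (odd n)) => oddn.
  rewrite root_mx_odd // mxE; case: eqP => [->|_]; last by rewrite !mulr0.
  by case: eqP => [->|_]; last by rewrite !mulr0.
rewrite root_mx_even // !mxE !mulrDr; congr (_ + _).
  case: eqP => [->|_]; last by rewrite !mulr0.
  by case: eqP => [->|_]; last by rewrite !mulr0.
case: eqP => [->|_]; last by rewrite !mulr0.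
case: eqP => [->|_]; last by rewrite !mulr0.
by rewrite !gen_diag_rev // opprK addrC.
Qed.

Lemma root_mx_twist i j : ~~ odd n -> E i j = delta_mx i j - twist (delta_mx i j).
Proof.
move=> evn; rewrite root_mx_even //; congr (_ + _); apply/matrixP=> a b.
rewrite !mxE !rev_ord_eq andbC; case: eqP => [->|_]; last by rewrite !mulr0 oppr0.
case: eqP => [->|_]; last by rewrite !mulr0 oppr0.
rewrite !mulr1 -[in RHS]signr_odd oddD !odd_rev_ord //.
by case: (odd i); case: (odd j); rewrite /= ?expr0 ?expr1 ?opprK.
Qed.

Lemma gen_offdiag_mem U A : (forall i j, i != j -> E i j \in U) -> A \in g ->
  A - diag_mx (\row_k A k k) \in U.
Proof.
move=> UE gA; pose O : 'M[K]_n := \matrix_(i, j) (A i j *+ (i != j)).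
have UO : \sum_i \sum_j O i j *: E i j \in U.
  apply: memv_suml => i _; apply: memv_suml => j _; rewrite mxE.
  by have [_|ij] := eqVneq i j; rewrite ?scale0r ?mem0v // rpredZ ?UE.
suff [c ->] : exists c : K, A - diag_mx (\row_k A k k) = c *: \sum_i \sum_j O i j *: E i j.
  by rewrite rpredZ.
have -> : A - diag_mx (\row_k A k k) = O.
  apply/matrixP=> i j; rewrite !mxE.
  by have [->|_] := eqVneq i j; rewrite ?mulr1n ?subrr ?mulr0n ?subr0.
case: (boolP (odd n)) => oddn.
  exists 1; rewrite scale1r {1}[O]matrix_sum_delta.
  by apply: eq_bigr => i _; apply: eq_bigr => j _; rewrite root_mx_odd.
(* The off-diagonal part satisfies [twist O = - O], so [2 O = O - twist O], which expands into root
   vectors by [root_mx_twist]. *)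
exists 2^-1; apply: (canRL (scalerK two_neq0)).
transitivity (O - twist O).
  apply/matrixP=> i j; rewrite !mxE (inj_eq rev_ord_inj) eq_sym.
  case: eqP => [_|_]; first by rewrite !mulr0n !mulr0 subr0.
  rewrite !mulr1n (gen_symplectic n_ge3 g_gen) // !mulNr mulrN signrMK opprK; ring.
rewrite {1 2}[O]matrix_sum_delta linear_sum -sumrB; apply: eq_bigr => i _.
rewrite linear_sum -sumrB; apply: eq_bigr => j _.
by rewrite linearZ /= -scalerBr root_mx_twist.
Qed.

Lemma ideal_has_root_mx U : lie_ideal g U -> U != 0%VS ->
  exists i j, i != j /\ E i j \in U.
Proof.
case=> /subvP sUg idU; rewrite -vpick0; set A := vpick U => A0.
have UA : A \in U by apply: memv_pick.
have gA := sUg _ UA.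
have gE := gen_root_mx charK0 n_ge3 g_gen.
have adE a b c : a != b -> c != 0 -> E b a *m A *m E b a = c *: E b a ->
    exists i j, i != j /\ E i j \in U.
  move=> ab c0 e; exists b, a; split; first by rewrite eq_sym.
  have gEba : E b a \in g by rewrite gE // eq_sym.
  have := idU _ _ gEba (idU _ _ gEba UA).
  rewrite lie_br_sqr0 ?root_mx_sqr 1?eq_sym // e scalerA rpredZeq mulf_eq0 oppr_eq0.
  by rewrite (negbTE two_neq0) (negbTE c0).
have [A_diag|] := boolP (is_diag_mx A).
  (* A diagonal [A] scales [E i j] by [A i i - A j j], so two distinct diagonal entries suffice. *)
  suff [i [j nij]] : exists i j, A i i != A j j.
    exists i, j; have ij : i != j by apply: contraNneq nij => ->.
    split=> //; have := idU _ _ (gE _ _ ij) UA; rewrite lie_brC lie_br_root_mx //.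
    by rewrite rpredN rpredZeq subr_eq0 (negbTE nij).
  have [i Ai0] : exists i, A i i != 0.
    apply/existsP; apply: contraR A0; rewrite negb_exists => /forallP Az.
    apply/eqP/matrixP=> i j; rewrite [RHS]mxE.
    have [<-|ij] := eqVneq i j; first by apply/eqP; rewrite -[_ == _]negbK Az.
    exact: (is_diag_mxP A_diag).
  (* For even [n] the entries at [i] and [rev_ord i] are opposite; for odd [n] a constant diagonal
     would have trace [n * A i i], which is nonzero. *)
  have [oddn|evn] := boolP (odd n); last first.
    exists i, (rev_ord i); rewrite gen_diag_rev // -addr_eq0 -mulr2n -mulr_natr.
    by rewrite mulf_eq0 negb_or Ai0.
  have [/existsP[j]|] := boolP [exists j, A i i != A j j]; first by exists i, j.
  rewrite negb_exists => /forallP Aij; have := gen_trace n_ge3 g_gen gA.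
  rewrite /mxtrace (eq_bigr (fun=> A i i)) => [|j _]; last first.
    by apply/eqP; rewrite eq_sym -[_ == _]negbK.
  move/eqP; rewrite sumr_const card_ord -mulr_natr mulf_eq0.
  by rewrite (negbTE Ai0) (negbTE n_neq0).
move=> A_ndiag.
have [a [b [ab Aab]]] : exists a b, a != b /\ A a b != 0.
  suff /existsP[a /existsP[b /andP[ab Aab]]] : [exists a, exists b, (a != b) && (A a b != 0)].
    by exists a, b.
  apply: contraR A_ndiag => Az; apply/is_diag_mxP=> a b ab.
  apply/eqP; apply: contraR Az => Aab; apply/existsP; exists a; apply/existsP; exists b.
  by rewrite Aab andbT.
have [oddn|evn] := boolP (odd n).
  by apply: (adE a b (A a b)) => //; rewrite root_mx_odd // mul_delta_mx_delta.
(* Antidiagonal entries come first: they are detected by long root vectors, which are twice a single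
   matrix unit. *)
have [/existsP[c Ac]|] := boolP [exists c, A c (rev_ord c) != 0].
  apply: (adE c (rev_ord c) (2 * A c (rev_ord c))).
  - by rewrite eq_sym rev_ord_neq.
  - by rewrite mulf_neq0.
  have -> : E (rev_ord c) c = 2 *: delta_mx (rev_ord c) c.
    by rewrite -{2 4}[c]rev_ordK root_mx_long.
  by rewrite -!scalemxAl -scalemxAr mul_delta_mx_delta !scalerA; congr (_ *: _); ring.
rewrite negb_exists => /forallP A_long; have {}A_long c : A c (rev_ord c) = 0.
  by apply/eqP; rewrite -[_ == _]negbK.
(* The mixed terms of [E b a *m A *m E b a] carry antidiagonal entries of [A], now zero; the
   symplectic relation merges the other two into a multiple of [E b a]. *)
apply: (adE a b (A a b)) => //.
have A_long' : A (rev_ord b) b = 0 by rewrite -{2}[b]rev_ordK.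
rewrite root_mx_even // !mulmxDl !mulmxDr -!scalemxAl -!scalemxAr !mul_delta_mx_delta.
rewrite A_long A_long' !scale0r !scaler0 addr0 add0r scalerDr; congr (_ + _).
rewrite (gen_symplectic n_ge3 g_gen) // !scalerA; congr (_ *: _).
rewrite -[(-1) ^+ (_ + _)]signr_odd oddD.
by case: (odd a); case: (odd b); rewrite /= ?expr0 ?expr1; ring.
Qed.

Lemma gen_simple : lie_simple g.
Proof.
have gE := gen_root_mx charK0 n_ge3 g_gen.
split; first exact: gen_subalg.
  have [k0 k1 k2] : [/\ (0 < n)%N, (1 < n)%N & (2 < n)%N] by split; lia.
  exists (E (Ordinal k0) (Ordinal k1)), (E (Ordinal k1) (Ordinal k2)); split; try exact: gE.
  have [||| c c0 ->] := @root_mxM K n charK0 (Ordinal k0) (Ordinal k1) (Ordinal k2) => //.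
  by rewrite scaler_eq0 (negbTE c0) root_mx_neq0.
move=> U idU; have [->|U0] := eqVneq U 0%VS; [by left | right].
have [i [j [ij Uij]]] := ideal_has_root_mx idU U0.
have UE := ideal_root_mx charK0 n_ge3 gE idU ij Uij.
(* An ideal is a subalgebra, so by minimality of [g] it is enough to find both generators in [U]. *)
case: idU => sUg idU; apply/eqP; rewrite eqEsubv sUg; case: (g_gen) => _ _; apply.
  by move=> A B /(subvP sUg) gA UB; apply: idU.
have k0 : (0 < n)%N by lia.
have km : (n.-1 < n)%N by lia.
have [||c c0 cE] := @root_mx_corner K n charK0 n_ge3 (Ordinal km) (Ordinal k0); rewrite /= ?prednK //.
move=> A; rewrite !inE => /orP[] /eqP->; last first.
  have : E (Ordinal km) (Ordinal k0) \in U by rewrite UE // -val_eqE /=; lia.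
  by rewrite cE rpredZeq (negbTE c0).
(* [shift_mx] has zero diagonal, so it equals its off-diagonal part. *)
have := gen_offdiag_mem UE (gen_shift g_gen); congr (_ \in U).
rewrite -[RHS]subr0; congr (_ - _); apply/matrixP=> a b; rewrite !mxE.
by rewrite ltn_eqF // mul0rn.
Qed.

End SimpleAlgebra.

(** * The diagonal Cartan subalgebra and its roots *)

Section CartanSubalgebra.
Variables (K : fieldType) (n : nat).
Hypotheses (charK0 : [pchar K] =i pred0) (n_ge3 : (3 <= n)%N).
Variable g : {vspace 'M[K]_n}.
Hypothesis g_gen : lie_generated_by [:: shift_mx K n; corner_mx K n] g.
Implicit Types (i j k l : 'I_n) (A B h : 'M[K]_n) (U : {vspace 'M[K]_n}).

Local Notation E := (root_mx K).
Let two_neq0 : (2 : K) != 0. Proof. exact: (natr_neq0 charK0). Qed.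
Let n_neq0 : (n%:R : K) != 0. Proof. by apply: (natr_neq0 charK0); lia. Qed.
Let gE := gen_root_mx charK0 n_ge3 g_gen.

(** A spanning family rather than a basis: for odd [n] these matrices sum to zero, for even [n]
    those at [k] and [rev_ord k] are opposite. *)
Definition cartan_mx k : 'M[K]_n :=
  if odd n then delta_mx k k - n%:R^-1 *: 1%:M
  else delta_mx k k - delta_mx (rev_ord k) (rev_ord k).

Definition cartan : {vspace 'M[K]_n} := <<[tuple cartan_mx k | k < n]>>%VS.

Lemma cartan_mx_memv k : cartan_mx k \in cartan.
Proof. by apply/memv_span/mapP; exists k; rewrite ?mem_enum. Qed.

Lemma cartan_mxE k i :
  cartan_mx k i i = (i == k)%:R - (if odd n then n%:R^-1 else (i == rev_ord k)%:R).
Proof. by rewrite /cartan_mx; case: ifP => _; rewrite !mxE !andbb ?eqxx ?mulr1. Qed.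

Lemma cartan_mx_diag k : is_diag_mx (cartan_mx k).
Proof.
apply/is_diag_mxP=> i j ij.
have e l : (i == l) && (j == l) = false.
  by apply: contraNF ij => /andP[/eqP-> /eqP->].
rewrite /cartan_mx; case: ifP => _; rewrite !mxE !e; last by rewrite subr0.
by rewrite (negbTE (ij : i != j)) mulr0 subr0.
Qed.

Lemma cartan_mx_mem k : cartan_mx k \in g.
Proof.
have gL := gen_subalg g_gen.
rewrite /cartan_mx; case: (boolP (odd n)) => oddn.
  have -> : delta_mx k k - n%:R^-1 *: 1%:M =
      n%:R^-1 *: \sum_j (delta_mx k k - delta_mx j j) :> 'M[K]_n.
    rewrite sumrB sumr_const card_ord scalerBr -scaler_nat scalerA mulVf // scale1r.
    by congr (_ - _ *: _); apply/matrixP=> a b; rewrite mx1_sum_delta.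
  rewrite rpredZ // memv_suml // => j _.
  have [->|kj] := eqVneq j k; first by rewrite subrr mem0v.
  have -> : delta_mx k k - delta_mx j j = lie_br (E k j) (E j k).
    by rewrite !root_mx_odd // /lie_br !mul_delta_mx.
  by apply: gL; apply: gE; rewrite // eq_sym.
have long := root_mx_long K (rev_ord k) oddn; rewrite rev_ordK in long.
have kk := rev_ord_neq k oddn.
(* Each of the two long root vectors contributes a factor 2. *)
have -> : delta_mx k k - delta_mx (rev_ord k) (rev_ord k) =
    2^-1 *: (2^-1 *: lie_br (E k (rev_ord k)) (E (rev_ord k) k)).
  by rewrite long root_mx_long // lie_brZl lie_brZr !scalerK // /lie_br !mul_delta_mx.
by do 2!apply: rpredZ; apply: gL; apply: gE; rewrite // eq_sym.
Qed.

Lemma mem_cartan A : (A \in cartan) = (A \in g) && is_diag_mx A.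
Proof.
apply/idP/andP => [HA|[gA A_diag]].
  split.
    apply: (subvP (_ : (cartan <= g)%VS)) HA; apply/span_subvP => _ /mapP[k _ ->].
    exact: cartan_mx_mem.
  rewrite (coord_span HA); apply/is_diag_mxP=> i j ij; rewrite summxE big1 // => k _.
  by rewrite mxE -tnth_nth tnth_mktuple (is_diag_mxP (cartan_mx_diag k)) ?mulr0.
(* The sum has diagonal entries [A i i - tr A / n = A i i] for odd [n] and [A i i - A (rev_ord i)
   (rev_ord i) = 2 A i i] for even [n], whence [c]. *)
suff [c ->] : exists c : K, A = c *: \sum_k A k k *: cartan_mx k.
  by rewrite rpredZ // memv_suml // => k _; rewrite rpredZ ?cartan_mx_memv //.
have sumE i : (\sum_k A k k *: cartan_mx k) i i =
    A i i - (if odd n then n%:R^-1 * \tr A else A (rev_ord i) (rev_ord i)).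
  have pick p : \sum_k A k k * (p == k)%:R = A p p.
    rewrite (bigD1 p) //= eqxx mulr1 big1 ?addr0 // => k.
    by rewrite eq_sym => /negbTE->; rewrite mulr0.
  rewrite summxE (eq_bigr (fun k => A k k * (i == k)%:R -
      A k k * (if odd n then n%:R^-1 else (rev_ord i == k)%:R))) => [|k _].
    by rewrite sumrB pick; case: ifP => _; rewrite ?pick // -mulr_suml mulrC.
  by rewrite mxE cartan_mxE mulrBr rev_ord_eq.
have sum_diag : is_diag_mx (\sum_k A k k *: cartan_mx k).
  apply/is_diag_mxP=> i j ij; rewrite summxE big1 // => k _.
  by rewrite mxE (is_diag_mxP (cartan_mx_diag k)) ?mulr0.
have diag_eq (c : K) : (forall i, A i i = c * (\sum_k A k k *: cartan_mx k) i i) ->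
    A = c *: \sum_k A k k *: cartan_mx k.
  move=> AE; apply/matrixP=> i j; rewrite [RHS]mxE.
  have [<-//|ij] := eqVneq i j.
  by rewrite (is_diag_mxP A_diag) // (is_diag_mxP sum_diag) ?mulr0.
case: (boolP (odd n)) => oddn.
  by exists 1; apply: diag_eq => i; rewrite sumE oddn (gen_trace n_ge3 g_gen gA) mulr0 subr0 mul1r.
exists 2^-1; apply: diag_eq => i; apply: (canRL (mulKf two_neq0)).
by rewrite sumE (negbTE oddn) (gen_diag_rev n_ge3 g_gen) //; ring.
Qed.

(** The difference is 1, or 2 if [n] is even and [j = rev_ord i]. It shows both that the Cartan
    subalgebra is self-normalizing and that the weights are nonzero. *)
Lemma cartan_weight_neq i j : i != j -> cartan_mx i i i != cartan_mx i j j.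
Proof.
move=> ij; rewrite !cartan_mxE eqxx [j == i]eq_sym (negbTE ij) -subr_eq0.
case: (boolP (odd n)) => oddn; first by rewrite opprB addrA subrK subr0 oner_eq0.
rewrite [i == rev_ord i]eq_sym (negbTE (rev_ord_neq _ _)) //.
case: (j == _); first by rewrite subr0 sub0r opprK.
by rewrite !subr0 oner_eq0.
Qed.

Lemma lie_br_cartan h A : is_diag_mx h -> is_diag_mx A -> lie_br h A = 0.
Proof.
move=> h_diag A_diag; apply/matrixP=> i j; rewrite lie_br_diag // [RHS]mxE.
have [->|ij] := eqVneq i j; first by rewrite subrr mul0r.
by rewrite (is_diag_mxP A_diag) ?mulr0.
Qed.

Lemma cartan_splitting : splitting_cartan g cartan.
Proof.
have HP A : A \in cartan -> A \in g /\ is_diag_mx A by rewrite mem_cartan => /andP.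
have HH A B : A \in cartan -> B \in cartan -> lie_br A B = 0.
  by move=> /HP[_ Ad] /HP[_ Bd]; apply: lie_br_cartan.
split; first split.
- by apply/subvP=> A /HP[].
- by move=> A B HA HB; rewrite HH ?mem0v.
- exists 1%N; apply/eqP; rewrite /= -subv0; apply/lie_prodvP => A B HA HB.
  by rewrite HH ?mem0v.
- move=> z gz Hz; rewrite mem_cartan gz; apply/is_diag_mxP=> i j ij.
  have /HP[_ /is_diag_mxP/(_ i j ij)] := Hz _ (cartan_mx_memv i).
  rewrite lie_brC mxE lie_br_diag ?cartan_mx_diag // => /eqP.
  by rewrite oppr_eq0 mulf_eq0 subr_eq0 (negbTE (cartan_weight_neq ij)) => /eqP.
move=> h /HP[gh h_diag].
(* Common eigenvectors spanning [g]: diagonal matrices and root vectors. *)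
pose X := [seq cartan_mx k | k <- enum 'I_n] ++
  [seq E p.1 p.2 | p <- enum {: 'I_n * 'I_n} & p.1 != p.2].
apply: (@ad_triangularizable_eigen _ _ _ X); last first.
  move=> v; rewrite mem_cat => /orP[] /mapP[p]; last first.
    by move=> _ ->; exists (h p.1 p.1 - h p.2 p.2); rewrite (lie_br_root_mx n_ge3 g_gen).
  by move=> _ ->; exists 0; rewrite scale0r lie_br_cartan ?cartan_mx_diag.
apply/eqP; rewrite eqEsubv; apply/andP; split.
  apply/span_subvP=> v; rewrite mem_cat => /orP[] /mapP[p]; first by move=> _ ->; apply: cartan_mx_mem.
  by rewrite mem_filter => /andP[ij _] ->; apply: gE.
apply/subvP => A gA.
have XE i j : i != j -> E i j \in <<X>>%VS.
  move=> ij; apply: memv_span; rewrite mem_cat; apply/orP; right; apply/mapP.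
  by exists (i, j); rewrite // mem_filter ij mem_enum.
have offX := gen_offdiag_mem charK0 n_ge3 g_gen XE gA.
have offg := gen_offdiag_mem charK0 n_ge3 g_gen gE gA.
rewrite -[A](subrK (diag_mx (\row_k A k k))) rpredD //.
have : diag_mx (\row_k A k k) \in cartan.
  by rewrite mem_cartan diag_mx_is_diag andbT -[X in X \in _](subKr A) rpredB.
apply/subvP; apply/span_subvP => _ /mapP[k _ ->].
by apply: memv_span; rewrite mem_cat map_f ?mem_enum.
Qed.

Definition weight_fun i j (h : subvs_of cartan) : K^o := (vsval h) i i - (vsval h) j j.

Fact weight_is_linear i j : linear (weight_fun i j).
Proof. by move=> c u v; rewrite /weight_fun linearP !mxE /GRing.scale /=; ring. Qed.
HB.instance Definition _ i j :=
  GRing.isLinear.Build K (subvs_of cartan) K^o _ (weight_fun i j) (weight_is_linear i j).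

Definition weight i j : 'Hom(subvs_of cartan, K^o) := linfun (weight_fun i j).

Lemma weightE i j (h : subvs_of cartan) : weight i j h = (vsval h) i i - (vsval h) j j.
Proof. by rewrite lfunE. Qed.

(** A nonzero off-diagonal entry [(i, j)] of a root vector forces its root to be [weight i j]; a
    diagonal root vector would force the root to be 0. *)
Lemma is_root_cartan (a : 'Hom(subvs_of cartan, K^o)) :
  is_root g a <-> exists i j, i != j /\ a = weight i j.
Proof.
have HP (h : subvs_of cartan) : vsval h \in g /\ is_diag_mx (vsval h).
  by apply/andP; rewrite -mem_cartan subvsP.
split=> [[a0 [z [gz z0 az]]]|[i [j [ij ->]]]].
  have [/existsP[i /existsP[j /andP[ij zij]]]|zd] :=
    boolP [exists i, exists j, (i != j) && (z i j != 0)].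
    exists i, j; split=> //; apply/lfunP => h; rewrite weightE.
    have [_ hd] := HP h; have /matrixP/(_ i j) := az h.
    by rewrite lie_br_diag // [RHS]mxE => /(mulIf zij).
  case/negP: a0; apply/eqP/lfunP => h; rewrite zero_lfunE.
  have z_diag : is_diag_mx z.
    apply/is_diag_mxP=> i j ij; apply/eqP; apply: contraR zd => zij.
    by apply/existsP; exists i; apply/existsP; exists j; rewrite zij andbT.
  have [_ hd] := HP h.
  have /eqP := az h; rewrite lie_br_cartan // eq_sym scaler_eq0 (negbTE z0) orbF.
  by move/eqP.
split; last first.
  exists (E i j); split; [exact: gE|exact: root_mx_neq0|] => h.
  by have [gh hd] := HP h; rewrite weightE (lie_br_root_mx n_ge3 g_gen).
apply/eqP => /lfunP/(_ (vsproj cartan (cartan_mx i))); rewrite weightE zero_lfunE.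
rewrite vsprojK ?cartan_mx_memv //.
by move/eqP; rewrite subr_eq0 (negbTE (cartan_weight_neq ij)).
Qed.

Section Coordinates.
Variables (N : nat) (t : 'I_N -> 'I_n).

(** The map [t] selects the coordinates: all indices for type A, the first half for type C. *)
Definition coords (a : 'Hom(subvs_of cartan, K^o)) : 'rV[K]_N :=
  \row_k a (vsproj cartan (cartan_mx (t k))).

Fact coords_is_linear : linear coords.
Proof. by move=> c a b; apply/rowP=> k; rewrite !mxE add_lfunE scale_lfunE. Qed.
HB.instance Definition _ := GRing.isLinear.Build K
  'Hom(subvs_of cartan, K^o) 'rV[K]_N _ coords coords_is_linear.

(** The spanning hypothesis makes [coords] injective, the second matches the roots with [R], and the
    last bounds the image by the span of [R]. *)
Lemma gen_of_type (R : seq 'rV[K]_N) :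
    (cartan <= <<[tuple cartan_mx (t k) | k < N]>>)%VS ->
    (forall w, w \in R <-> exists i j, i != j /\
       w = \row_k (cartan_mx (t k) i i - cartan_mx (t k) j j)) ->
    (forall a, coords a \in <<R>>%VS) ->
  of_type g R.
Proof.
move=> cartan_t RE aR.
split; first exact: gen_simple.
exists cartan; first exact: cartan_splitting.
exists (linfun coords).
have RP w : w \in R <-> exists2 a, is_root g a & linfun coords a = w.
  have wE i j : linfun coords (weight i j) =
      \row_k (cartan_mx (t k) i i - cartan_mx (t k) j j).
    by rewrite lfunE; apply/rowP=> k; rewrite !mxE weightE vsprojK ?cartan_mx_memv //.
  split=> [/RE[i [j [ij ->]]]|[a /is_root_cartan[i [j [ij ->]]] <-]].
    by exists (weight i j); rewrite // is_root_cartan; exists i, j.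
  by rewrite wE RE; exists i, j.
split=> //.
  apply/eqP; rewrite -subv0; apply/subvP => a; rewrite memv_ker memv0 lfunE => /eqP a0.
  apply/eqP/lfunP => h; rewrite zero_lfunE -[h]vsvalK.
  have ht := subvP cartan_t _ (subvsP h).
  rewrite (coord_span ht) !linear_sum big1 // => k _.
  rewrite -tnth_nth tnth_mktuple !linearZ /=.
  by move/rowP/(_ k): a0; rewrite !mxE => ->; rewrite scaler0.
apply/eqP; rewrite eqEsubv; apply/andP; split.
  by apply/subvP => _ /memv_imgP[a _ ->]; rewrite lfunE.
apply/span_subvP => w /RP[a _ <-]; exact: memv_img (memvf _).
Qed.
End Coordinates.

End CartanSubalgebra.

(** * Identification of the root systems *)

Section Types.
Variables (K : fieldType) (n : nat).
Hypotheses (charK0 : [pchar K] =i pred0) (n_ge3 : (3 <= n)%N).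
Variable g : {vspace 'M[K]_n}.
Hypothesis g_gen : lie_generated_by [:: shift_mx K n; corner_mx K n] g.

Lemma rowE_eps N (w : 'rV[K]_N) : w = \sum_k w 0 k *: eps K k.
Proof.
by rewrite {1}[w]matrix_sum_delta big_ord1.
Qed.

Lemma gen_type_A : odd n -> of_type g (rootsA K n.-1).
Proof.
move=> oddn; have nE : n.-1.+1 = n by rewrite prednK //; lia.
pose t : 'I_n.-1.+1 -> 'I_n := cast_ord nE.
have t_inj : injective t by apply: cast_ord_inj.
have tK k : t (cast_ord (esym nE) k) = k by apply: cast_ordKV.
have cartan_tE i j k : cartan_mx K (t k) (t i) (t i) - cartan_mx K (t k) (t j) (t j) =
    (eps K i - eps K j) 0 k.
  rewrite !cartan_mxE oddn !mxE eqxx !(inj_eq t_inj) /= ![k == _]eq_sym.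
  by ring.
have rootsAP w : w \in rootsA K n.-1 <-> exists i j, i != j /\ w = eps K i - eps K j.
  split=> [/mapP[[i j]]|[i [j [ij ->]]]].
    by rewrite mem_filter => /andP[ij _] ->; exists i, j.
  by apply/mapP; exists (i, j); rewrite // mem_filter ij mem_enum.
apply: (gen_of_type charK0 n_ge3 g_gen (t := t)).
- apply/span_subvP=> _ /mapP[k _ ->]; apply/memv_span/mapP.
  by exists (cast_ord (esym nE) k); rewrite ?tK ?mem_enum.
- move=> w; rewrite rootsAP; split=> [[i [j [ij ->]]]|[i [j [ij ->]]]].
    exists (t i), (t j); rewrite (inj_eq t_inj); split=> //.
    by apply/rowP=> k; rewrite [RHS]mxE cartan_tE.
  exists (cast_ord (esym nE) i), (cast_ord (esym nE) j); split.
    by rewrite (inj_eq (@cast_ord_inj _ _ _)).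
  by apply/rowP=> k; rewrite -cartan_tE !tK mxE.
move=> a; set w := coords t a.
(* The matrices [cartan_mx k] sum to zero, which places the image in the hyperplane spanned by the
   roots of type A. *)
have w0 : \sum_k w 0 k = 0.
  transitivity (a (vsproj (cartan K n) (\sum_k cartan_mx K (t k))) : K).
    by rewrite !linear_sum; apply: eq_bigr => k _; rewrite mxE.
  suff -> : \sum_k cartan_mx K (t k) = 0 by rewrite !linear0.
  have t_bij : bijective t by exists (cast_ord (esym nE)); [apply: cast_ordK | apply: tK].
  rewrite -(reindex (P := xpredT) (F := @cartan_mx K n) t (onW_bij _ t_bij)).
  rewrite /cartan_mx oddn sumrB sumr_const card_ord -mx1_sum_delta -scaler_nat scalerA.
  by rewrite mulfV ?scale1r ?subrr // natr_neq0 //; lia.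
rewrite [w]rowE_eps.
have -> : \sum_k w 0 k *: eps K k = \sum_k w 0 k *: (eps K k - eps K ord0).
  by under [RHS]eq_bigr do rewrite scalerBr; rewrite sumrB -scaler_suml w0 scale0r subr0.
apply: memv_suml => k _; apply: rpredZ.
have [->|k0] := eqVneq k ord0; first by rewrite subrr mem0v.
by apply: memv_span; apply/rootsAP; exists k, ord0.
Qed.

Lemma gen_type_C (m : nat) : n = (2 * m)%N -> of_type g (rootsC K m).
Proof.
move=> nE; have evn : ~~ odd n by lia.
have le_mn : (m <= n)%N by lia.
pose t : 'I_m -> 'I_n := widen_ord le_mn.
(* Signed indices: the diagonal entry at [idx s p] is the functional [+-e_p], negative when [s]
   holds. *)
pose idx (s : bool) p := if s then rev_ord (t p) else t p.
have idxP i : exists s p, i = idx s p.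
  have [lt|ge] := ltnP i m.
    by exists false, (Ordinal lt); apply/val_inj.
  have lt : (rev_ord i < m)%N by rewrite /=; have := ltn_ord i; lia.
  exists true, (Ordinal lt); apply/val_inj => /=; have := ltn_ord i; lia.
have idx_inj s s' p q : (idx s p == idx s' q) = (s == s') && (p == q).
  rewrite -!val_eqE /=; have := ltn_ord p; have := ltn_ord q.
  by case: s; case: s' => /=; lia.
have cartan_tE s p k : cartan_mx K (t k) (idx s p) (idx s p) = (pm K s *: eps K p) 0 k.
  rewrite cartan_mxE (negbTE evn) -[t k]/(idx false k) -[rev_ord _]/(idx true k).
  rewrite !idx_inj !mxE eqxx [k == p]eq_sym /= /pm.
  by case: s; rewrite /= ?expr0 ?expr1; ring.
have cartan_tB s s' p q :
    \row_k (cartan_mx K (t k) (idx s p) (idx s p) - cartan_mx K (t k) (idx s' q) (idx s' q))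
    = pm K s *: eps K p + pm K (~~ s') *: eps K q.
  apply/rowP=> k; rewrite mxE !cartan_tE !mxE /pm.
  by case: s'; rewrite /= ?expr0 ?expr1; ring.
have pm2 s p : pm K s *: eps K p + pm K s *: eps K p = pm K s *: (eps K p *+ 2).
  by rewrite -scalerDr mulr2n.
apply: (gen_of_type charK0 n_ge3 g_gen (t := t)).
- apply/span_subvP=> _ /mapP[k _ ->].
  have tmem p : cartan_mx K (t p) \in <<[tuple cartan_mx K (t k) | k < m]>>%VS.
    by apply/memv_span/mapP; exists p; rewrite ?mem_enum.
  have [[] [p ->]] := idxP k; last exact: tmem.
  suff -> : cartan_mx K (idx true p) = - cartan_mx K (t p) by rewrite rpredN.
  by rewrite /cartan_mx (negbTE evn) rev_ordK opprB.
- move=> w; split.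
    rewrite mem_cat => /orP[] /allpairsP[].
      move=> [[p q] [s s']] /= [+ _ ->].
      rewrite mem_filter => /andP[pq _]; exists (idx s p), (idx (~~ s') q).
      rewrite cartan_tB negbK idx_inj; split=> //.
      by rewrite negb_and -[p == q]val_eqE (ltn_eqF pq) orbT.
    move=> [p s] /= [_ _ ->]; exists (idx s p), (idx (~~ s) p).
    by rewrite cartan_tB negbK pm2 idx_inj; split=> //; case: s.
  move=> [i [j [+ ->]]]; have [s [p ->]] := idxP i; have [s' [q ->]] := idxP j.
  rewrite cartan_tB idx_inj mem_cat => ij; apply/orP.
  have [pq|qp|/val_inj pq] := ltngtP p q.
  + left; apply/allpairsP; exists ((p, q), (s, ~~ s')).
    by rewrite mem_filter /= pq !mem_enum.
  + left; apply/allpairsP; exists ((q, p), (~~ s', s)).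
    by rewrite mem_filter /= qp !mem_enum addrC.
  (* Equal positions must have opposite signs [s] and [s'], which gives the long roots [+-2 e_p]. *)
  right; apply/allpairsP; exists (p, s); rewrite !mem_enum -pm2 -pq /=; split=> //.
  by move: ij; rewrite pq eqxx andbT; case: s; case: s'.
move=> a; rewrite [coords _ _]rowE_eps; apply: memv_suml => k _; apply: rpredZ.
have -> : eps K k = 2^-1 *: (pm K false *: (eps K k *+ 2)).
  by rewrite /pm expr0 scale1r -scaler_nat scalerK // natr_neq0.
apply: rpredZ; apply: memv_span; rewrite mem_cat; apply/orP; right.
by apply/allpairsP; exists (k, false); rewrite !mem_enum.
Qed.

End Types.

Theorem proposition2p5 (K : fieldType) (n : nat) (charK0 : [pchar K] =i pred0)
    (n_ge3 : (3 <= n)%N) (g : {vspace 'M[K]_n})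
    (g_gen : lie_generated_by [:: shift_mx K n; corner_mx K n] g) :
  [/\ lie_simple g,
      forall m : nat, n = (2 * m)%N -> of_type g (rootsC K m) &
      odd n -> of_type g (rootsA K n.-1)].
Proof.
split; first exact: gen_simple.
  by move=> m; apply: gen_type_C.
exact: gen_type_A.
Qed.
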